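(* Let $Q(x,y,z)$ be an irreducible complex quadratic form and let $P(x,y,z)$ be any complex polynomial of degree $d$. (1) The restriction $P|_{\mathcal S}$ of $P$ to the complex surface $\mathcal S=\{Q(x,y,z)=1\}$ admits a representation of the form $$P(x,y,z)=\lambda+\sum_{k=1}^{d}\ \prod_{l=1}^{k}L_{k,l}(x,y,z),$$ where $\lambda\in\mathbb C$ and the linear forms $\{L_{k,l}\}$ are chosen so that each non-zero product $\prod_{l=1}^kL_{k,l}(x,y,z)$ is determined, via the map $\Phi_Q$, by an appropriate multipole $w_k$ from the variety $\mathcal M(k)$. (2) This representation is unique, up to a finite ambiguity and up to reordering and rescaling of multipliers in each product $\prod_{l=1}^kL_{k,l}(x,y,z)$. In other words, the set of $P$-representing (sequences of) multipoles $\{w_k\in\overline{\mathcal M}(k)\}_{1\le k\le d}$ is finite. Its cardinality does not exceed $\prod_{k=1}^{d}[(2k-1)!!]$.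
   Context: $V(k)$ is the space of homogeneous complex polynomials of degree $k$ in $x,y,z$ (with $0$), $V_Q(k)=Q\cdot V(k-2)$, and $V_Q^\perp(k)$ is the orthogonal complement of $V_Q(k)$ in $V(k)$ for a Hermitian inner product, identified with $V(k)/V_Q(k)$. For a vector space $V$, $V^\circ=V\setminus\{0\}$. $H_k=\{(\lambda_i)\in(\mathbb C^\ast)^k:\prod\lambda_i=1\}$; $\Sigma_k$ is the group generated by $H_k$ (rescaling) and the symmetric group $S_k$ (permuting); $\mathcal M(k)=[V(1)^\circ]^k/\Sigma_k$ is the space of multipoles. $\mathcal M(k)$ is in bijection with the set of nonzero products of $k$ linear forms. $\overline{\mathcal M}(k)=\mathcal M(k)\cup\{\mathbf 0\}$, where $\mathbf 0$ represents the zero product. $\Phi_Q:\mathcal M(k)\to V_Q^\perp(k)^\circ$ sends the class of $(L_1,\dots,L_k)$ to the class of $\prod_iL_i$ modulo $Q$. Rescaling of the multipliers of a product of linear forms means multiplying them by constants with product $1$. $(2k-1)!!=1\cdot3\cdots(2k-1)$. *)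

(* Defs.v *)
(* The complex numbers are R[i] with R : realType; the definitions below make
   sense over any field C. *)
From HB Require Import structures.
From mathcomp Require Import all_boot all_order all_algebra all_fingroup.
From mathcomp Require Import generic_quotient ring_quotient.
From mathcomp Require Import mpoly complex.
From mathcomp Require Import boolp classical_sets functions cardinality reals.

Set Implicit Arguments.
Unset Strict Implicit.
Unset Printing Implicit Defensive.

Import GRing.Theory.
Local Open Scope ring_scope.
Local Open Scope quotient_scope.

Definition irreducible_elt (A : idomainType) (p : A) : Prop :=
  [/\ p != 0, p \isn't a GRing.unit &
      forall a b : A, p = a * b -> a \is a GRing.unit \/ b \is a GRing.unit].

(* Total degree; the zero polynomial gets degree 0. *)
Definition mpoly_deg (n : nat) (C : nzRingType) (p : {mpoly C[n]}) : nat :=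
  (msize p).-1.

(* (2k-1)!! *)
Definition odd_dfact (k : nat) : nat := \prod_(1 <= i < k.+1) (2 * i - 1).

Section Multipoles.
Variable C : fieldType.

Definition V (k : nat) : Type := dhomog 3 C k.
HB.instance Definition _ k := Vector.on (V k).

Lemma prod_linear_homog k (L : 'I_k -> V 1) :
  \prod_(l < k) (L l : {mpoly C[3]}) \is k.-homog.
Proof.
elim: k L => [|k IHk] L; first by rewrite big_ord0 dhomog1.
rewrite big_ord_recl; apply: (@dhomogM 3 C mdeg 1 _ k) (IHk _).
exact: dhomog_is_dhomog.
Qed.

Definition linprod k (L : 'I_k -> V 1) : V k := DHomog (prod_linear_homog L).

Definition linear_form0 : Type := {L : V 1 | L != 0}.
HB.instance Definition _ := Choice.on linear_form0.

Definition mtuple (k : nat) : Type := {ffun 'I_k -> linear_form0}.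
HB.instance Definition _ k := Choice.on (mtuple k).

Record rescaling (k : nat) := Rescaling {
  rescaling_val :> 'I_k -> C;
  rescaling_neq0 : forall i, rescaling_val i != 0;
  rescaling_prod : \prod_(i < k) rescaling_val i = 1
}.

Lemma rescale_subproof k (h : rescaling k) (L : mtuple k) i : h i *: val (L i) != 0.
Proof. by rewrite scaler_eq0 negb_or rescaling_neq0 (valP (L i)). Qed.

Definition rescale k (h : rescaling k) (L : mtuple k) : mtuple k :=
  [ffun i => exist (fun v : V 1 => v != 0) _ (rescale_subproof h L i)].

Definition permute k (s : 'S_k) (L : mtuple k) : mtuple k :=
  [ffun i => L (s i)].

(* Both families of generators are closed under inverses and [permute 1] is
   the identity, so closing under composition gives the generated group. *)
Inductive Sigma (k : nat) : (mtuple k -> mtuple k) -> Prop :=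
| Sigma_rescale (h : rescaling k) : Sigma (rescale h)
| Sigma_permute (s : 'S_k) : Sigma (permute s)
| Sigma_comp f g : Sigma f -> Sigma g -> Sigma (f \o g).

Definition same_orbit k (L L' : mtuple k) : bool :=
  `[< exists2 g, Sigma g & L' = g L >].

Lemma Hinv_subproof1 k (h : rescaling k) i : (h i)^-1 != 0.
Proof. by rewrite invr_eq0 rescaling_neq0. Qed.

Lemma Hinv_subproof2 k (h : rescaling k) : \prod_(i < k) (h i)^-1 = 1.
Proof. by rewrite prodfV rescaling_prod invr1. Qed.

Lemma Sigma_inv k (g : mtuple k -> mtuple k) :
  Sigma g -> exists2 g', Sigma g' & cancel g g'.
Proof.
elim=> [h|s|f1 f2 _ [g1 Sg1 K1] _ [g2 Sg2 K2]].
- exists (rescale (Rescaling (Hinv_subproof1 h) (Hinv_subproof2 h))).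
    exact: Sigma_rescale.
  move=> L; apply/ffunP => i; apply/val_inj; rewrite !ffunE /= ffunE /=.
  by rewrite scalerA mulVf ?scale1r ?rescaling_neq0.
- exists (permute s^-1); first exact: Sigma_permute.
  by move=> L; apply/ffunP => i; rewrite !ffunE permKV.
- exists (g2 \o g1); first exact: Sigma_comp.
  by move=> L /=; rewrite K1 K2.
Qed.

Lemma same_orbit_equiv k : equiv_class_of (@same_orbit k).
Proof.
split=> [L|L L'|L2 L1 L3].
- apply/asboolP; exists (permute 1); first exact: Sigma_permute.
  by apply/ffunP => i; rewrite !ffunE perm1.
- suff sym A B : @same_orbit k A B -> same_orbit B A by apply/idP/idP; apply: sym.
  move=> /asboolP[g /Sigma_inv[g' Sg' gK] ->]; apply/asboolP.
  by exists g'; rewrite ?gK.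
- move=> /asboolP[f Sf ->] /asboolP[g Sg ->]; apply/asboolP.
  by exists (g \o f); first exact: Sigma_comp.
Qed.

Canonical same_orbit_equivRel k := EquivRelPack (same_orbit_equiv k).

Definition multipole (k : nat) : Type := {eq_quot (@same_orbit k)}.
HB.instance Definition _ k := EqQuotient.on (multipole k).

Definition tuple_prod k (L : mtuple k) : V k := linprod (fun i => val (L i)).

Definition mprod k (w : multipole k) : V k := tuple_prod (repr w).

Lemma tuple_prod_Sigma k (g : mtuple k -> mtuple k) L :
  Sigma g -> tuple_prod (g L) = tuple_prod L.
Proof.
move=> Sg; elim: Sg L => [h|s|f1 f2 _ IH1 _ IH2] L; last by rewrite /= IH1 IH2.
- apply/val_inj => /=; under eq_bigr do rewrite ffunE /= -mul_mpolyC.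
  by rewrite big_split /= -rmorph_prod rescaling_prod rmorph1 mul1r.
- apply/val_inj => /=; rewrite [RHS](reindex_inj (@perm_inj _ s)) /=.
  by apply: eq_bigr => i _; rewrite ffunE.
Qed.

Lemma mprod_pi k (L : mtuple k) : mprod (\pi_(multipole k) L) = tuple_prod L.
Proof.
have /asboolP[g Sg E] : same_orbit L (repr (\pi_(multipole k) L)).
  by apply/eqquotP; apply/esym; exact: reprK.
rewrite /mprod E; exact: tuple_prod_Sigma.
Qed.

(* [None] is the extra point representing the zero product. *)
Definition multipole_bar (k : nat) : Type := option (multipole k).

Definition mbarprod k (w : multipole_bar k) : V k :=
  if w is Some w' then mprod w' else 0.

Section Quadric.
Variable Q : V 2.

Lemma mulQ_homog j (A : V j) :
  (Q : {mpoly C[3]}) * (A : {mpoly C[3]}) \is j.+2.-homog.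
Proof. by rewrite -(addn2 j) addnC; apply: dhomogM; apply: dhomog_is_dhomog. Qed.

Definition mulQ j (A : V j) : V j.+2 := DHomog (mulQ_homog A).

Lemma mulQ_linear j : linear (@mulQ j).
Proof.
by move=> c A B; apply/val_inj; rewrite /= mulrDr scalerAr.
Qed.
HB.instance Definition _ j :=
  GRing.isLinear.Build C (V j) (V j.+2) _ (@mulQ j) (@mulQ_linear j).

(* V(k-2) = 0 for k < 2 *)
Definition VQ (k : nat) : {vspace V k} :=
  match k with
  | j.+2 => limg (linfun (@mulQ j))
  | _ => 0%VS
  end.

(* V(k)/V_Q(k), identified with the orthogonal complement of V_Q(k) in V(k) for
   any Hermitian inner product. *)
Definition quotVQ (k : nat) : zmodType := Quotient.quot (pred_of_vspace (VQ k)).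

Definition modQ k (p : V k) : quotVQ k := \pi_(Quotient.quot (pred_of_vspace (VQ k))) p.

Definition Phi k (w : multipole k) : quotVQ k := modQ (mprod w).

Lemma modQP k (p q : V k) : reflect (modQ p = modQ q) (p - q \in VQ k).
Proof.
by apply: (iffP idP) => [pq|/eqP]; [apply/eqP|]; rewrite -Quotient.idealrBE.
Qed.

Lemma Phi_pi k (L : mtuple k) :
  Phi (\pi_(multipole k) L) = modQ (tuple_prod L).
Proof. by rewrite /Phi mprod_pi. Qed.

(* w k is the multipole of degree k + 1, for 0 <= k < d. *)
Definition representing (P : {mpoly C[3]}) (d : nat) :
    set (forall k : 'I_d, multipole_bar k.+1) :=
  [set w | exists lam : C, forall v : 'I_3 -> C,
     meval v Q = 1 ->
     meval v P = lam + \sum_(k < d) meval v (mbarprod (w k))].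

End Quadric.
End Multipoles.

Arguments representing {C} Q P d _.

(* Main.v *)
Require Import Defs.
From mathcomp Require Import all_boot all_order all_algebra.
From mathcomp Require Import all_fingroup generic_quotient ring_quotient.
From mathcomp Require Import mpoly complex.
From mathcomp Require Import boolp classical_sets functions cardinality reals.
From mathcomp Require Import ring zify.
From HB Require Import structures.

(** The argument restricts forms to the conic [Q = 0]. Since [Q] is irreducible,
    it is [x z - y^2] in suitable coordinates ([conic_normal_form]), and the
    conic, minus a point at infinity, is parametrized by [t |-> (1, t, t^2)].
    Restriction to this curve is a ring morphism [rho] that kills [Q] and sends
    a form of degree [k] to a univariate polynomial of degree at most [2k]. In
    degree 1 it is a bijection onto the polynomials of degree at most 2
    ([rho1_inj], [rho1_surj]); in degree [k > 0] it is onto the polynomials of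
    degree at most [2k], because over an algebraically closed field such a
    polynomial is a product of [k] factors of degree at most 2
    ([rho_prod_surj]), and by a dimension count its kernel is exactly [VQ k]
    ([rho_ker]). Thus the quotient of [V k] by [VQ k] is the space of binary
    forms of degree [2k], in their inhomogeneous guise, and [Phi] sends a
    multipole to the corresponding product of [k] binary quadratic forms.

    Existence: the top form of [P] is congruent modulo [Q] to a product of
    linear forms, and on the surface [Q = 1] the multiple of [Q] left over has
    lower degree, so induction on the degree applies ([multipole_expansion]).

    Finiteness: if two sequences represent the same function on [Q = 1], the
    difference of their top products vanishes on the conic
    ([top_form_vanishes]), so the restriction of the top product to the conic is
    determined. Restriction identifies the multipoles with a given nonzero
    restriction of the product with the ways of grouping [2k] roots, counted
    with multiplicity and including infinity, into pairs, of which there are at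
    most [(2k-1)!!] ([count_quadratic_factorizations], [multipole_fiber_count]).
    Subtracting the top product and inducting on the number of multipoles gives
    the bound ([representing_count]). *)

Set Implicit Arguments.
Unset Strict Implicit.
Unset Printing Implicit Defensive.
Import GRing.Theory Num.Theory.
Local Open Scope ring_scope.

(** * Factorizations of univariate polynomials into quadratics *)

Lemma poly_eval_eq0 (R : numDomainType) (p : {poly R}) :
  (forall t : R, p.[t] = 0) -> p = 0.
Proof.
move=> p0; apply/eqP; apply: contraT => pn0.
have u : uniq [seq (i%:R : R) | i <- iota 0 (size p)].
  rewrite map_inj_uniq ?iota_uniq // => i j /eqP.
  by rewrite eqr_nat => /eqP.
have := max_poly_roots pn0 _ u; rewrite size_map size_iota ltnn.
by move=> -> //; apply/allP => x _; rewrite /root p0.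
Qed.

Section QuadraticFactorizations.
Variable C : numClosedFieldType.
Implicit Types (F f g p : {poly C}) (s : seq {poly C}).

Lemma poly_splitting p : p != 0 ->
  exists r : seq C, p = lead_coef p *: \prod_(z <- r) ('X - z%:P)
                    /\ size p = (size r).+1.
Proof.
move=> pn0; have [r Er] := closed_field_poly_normal p.
exists r; split=> //; rewrite {1}Er size_scale ?lead_coef_eq0 //.
exact: size_prod_XsubC.
Qed.

(** The size bounds [2 * k.+1 + 1] and [3] are those of the restrictions of
    ternary forms of degrees [k.+1] and [1] to a conic, so the statement also
    covers binary forms that vanish at infinity. *)
Lemma factor_into_quadratics k F : (size F <= (2 * k.+1).+1)%N ->
  exists f : nat -> {poly C}, (forall i, (size (f i) <= 3)%N)
    /\ F = \prod_(i < k.+1) f i.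
Proof.
elim: k F => [|k IH] F sF.
  exists (fun=> F); split; first by move=> _; exact: sF.
  by rewrite big_ord_recl big_ord0 mulr1.
have [s3|s3] := leqP (size F) 3.
  exists (fun i => if i is 0%N then F else 1); split.
    by case=> // i; rewrite size_poly1.
  by rewrite big_ord_recl big1 ?mulr1.
have Fn0 : F != 0 by rewrite -size_poly_gt0; lia.
(* Two of the roots of [F] are moved to a separate factor. *)
have [[|a [|b r]] [EF Es]] := poly_splitting Fn0; try by move: s3; rewrite Es.
pose G := lead_coef F *: \prod_(z <- r) ('X - z%:P).
have sG : (size G <= (2 * k.+1).+1)%N.
  rewrite /G size_scale ?lead_coef_eq0 // size_prod_XsubC.
  by move: sF; rewrite Es /=; lia.
have [f [sf Ef]] := IH _ sG.
exists (fun i => if i is j.+1 then f j else ('X - a%:P) * ('X - b%:P)); split.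
  by case=> // ; rewrite size_mul ?polyXsubC_eq0 // !size_XsubC.
by rewrite big_ord_recl /= -Ef EF !big_cons /G -!scalerAr mulrA.
Qed.

Lemma all_monic_prod s : all (fun f => f \is monic) s ->
  \prod_(f <- s) f \is monic.
Proof. by move=> /allP h; rewrite big_seq; apply: monic_prod => f; exact: h. Qed.

Lemma size_prod_quadratics s :
  all (fun f => (f \is monic) && (size f <= 3)%N) s ->
  (size (\prod_(f <- s) f)%R <= (2 * size s).+1)%N.
Proof.
elim: s => [_|f s IHs /= /andP[/andP[fm f3] /IHs sz]].
  by rewrite big_nil size_poly1.
rewrite big_cons; apply: leq_trans (size_polyMleq _ _) _.
by move: f3 sz => /=; lia.
Qed.

Lemma monic_root_factor f a : f \is monic -> (size f <= 3)%N -> root f a ->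
  f = 'X - a%:P \/ exists b, f = ('X - a%:P) * ('X - b%:P).
Proof.
move=> fm f3 fa; have [r [Er sr]] := poly_splitting (monic_neq0 fm).
move: Er fa; rewrite (monicP fm) scale1r => Ef.
rewrite Ef root_prod_XsubC => ar.
have : perm_eq r (a :: rem a r) by exact: perm_to_rem.
move=> /(perm_big _) -> /=; rewrite big_cons.
have := size_rem ar; case: (rem a r) => [|b [|c r']] /= Sr.
- by left; rewrite big_nil mulr1.
- by right; exists b; rewrite big_seq1.
- by move: f3; rewrite sr; lia.
Qed.

(** Up to order, a polynomial has at most [(2k-1)!!] factorizations into [k]
    monic factors of degree at most 2. Fix a root [a]: the factor that vanishes
    at [a] is ['X - a] times one of the remaining linear factors, the root at
    infinity giving the constant [1]; this leaves [2k-1] choices, and the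
    quotient is handled by induction. If there is no root, the polynomial and all
    its factors are 1. Monic factors account for rescaling: proportional
    polynomials have the same monic multiple. *)
Lemma count_quadratic_factorizations k F : exists l : seq (seq {poly C}),
  (size l <= odd_dfact k)%N /\
  forall s, size s = k -> all (fun f => (f \is monic) && (size f <= 3)%N) s ->
    \prod_(f <- s) f = F -> exists2 s', s' \in l & perm_eq s s'.
Proof.
elim: k F => [|k IH] F.
  exists [:: [::]]; split; first by rewrite /odd_dfact big_nil.
  by case=> // _ _ _; exists [::].
have dfS : odd_dfact k.+1 = (odd_dfact k * (2 * k.+1 - 1))%N.
  by rewrite /odd_dfact big_nat_recr.
have df0 : (0 < odd_dfact k)%N.
  by rewrite /odd_dfact big_nat prodn_cond_gt0 // => j; lia.
have [Fm|nFm] := boolP (F \is monic); last first.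
  exists [::]; split=> // s _ hs EF; case/negP: nFm; rewrite -EF.
  by apply: all_monic_prod; apply: sub_all hs => g /andP[].
have Fn0 := monic_neq0 Fm.
have [sF|sF] := leqP (size F) (2 * k.+1).+1; last first.
  exists [::]; split=> // s ss hs EF; move: sF; rewrite -EF.
  by rewrite ltnNge -ss size_prod_quadratics.
have [r [Er sr]] := poly_splitting Fn0.
rewrite (monicP Fm) scale1r in Er.
case: r Er sr => [|a r] EF sr.
  exists [:: nseq k.+1 1]; split; first by rewrite dfS /= muln_gt0 df0; lia.
  move=> s ss hs Es; exists (nseq k.+1 1); first by rewrite inE.
  suff -> : s = nseq k.+1 1 by [].
  move: Es; rewrite EF big_nil -ss.
  elim: s hs {ss} => //= f s IHs /andP[/andP[fm f3] hs]; rewrite big_cons => E.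
  have pm : \prod_(f <- s) f \is monic.
    by apply: all_monic_prod; apply: sub_all hs => g /andP[].
  have f1 : f = 1.
    have := size_mul (monic_neq0 fm) (monic_neq0 pm); rewrite E size_poly1 => S.
    have sf : size f = 1%N.
      have aux (a b : nat) : (1 = (a + b).-1 -> 0 < a -> 0 < b -> a = 1)%N by lia.
      by apply: (aux _ _ S); rewrite size_poly_gt0 monic_neq0.
    have /eqP fl := monicP fm; rewrite lead_coefE sf in fl.
    by rewrite (size1_polyC (eq_leq sf)) (eqP fl).
  by rewrite -IHs // ?f1 //; rewrite f1 mul1r in E.
(* The possible factors vanishing at [a]. The last one is present only when [F]
   has a root at infinity, so there are never more than [2 * k + 1] of them. *)
pose gs := [seq ('X - a%:P) * ('X - b%:P) | b <- r] ++
           (if (size F <= 2 * k.+1)%N then [:: 'X - a%:P] else [::]).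
have sgs : (size gs <= 2 * k.+1 - 1)%N.
  rewrite /gs size_cat size_map; move: sF sr => /=; case: ifP => /=; lia.
have [ell Hell] := choice IH.
exists (flatten [seq [seq g :: s | s <- ell (F %/ g)] | g <- gs]); split.
  rewrite size_flatten /shape -map_comp dfS mulnC.
  apply: leq_trans (_ : size gs * odd_dfact k <= _)%N;
    last by rewrite leq_mul2r sgs orbT.
  elim: gs {sgs} => //= g gs IHgs; rewrite mulSn; apply: leq_add IHgs.
  by rewrite size_map; have [] := Hell (F %/ g).
move=> s ss hs Es.
have : root (\prod_(f <- s) f) a by rewrite Es EF big_cons rootM root_XsubC eqxx.
move=> rs.
have [g gs_ ga] : exists2 g, g \in s & root g a.
  elim: s rs {ss hs Es} => [|f s IHs]; first by rewrite big_nil rootC oner_eq0.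
  rewrite big_cons rootM => /orP[fa|/IHs[g gs_ ga]].
    by exists f; rewrite ?mem_head.
  by exists g; rewrite // inE gs_ orbT.
have ps := perm_to_rem gs_.
have /andP[gm g3] := allP hs _ gs_.
have Eg : g * \prod_(f <- rem g s) f = F by rewrite -Es (perm_big _ ps) big_cons.
have hrem : all (fun f => (f \is monic) && (size f <= 3)%N) (rem g s).
  by apply/allP => f /mem_rem; exact: (allP hs).
have srem : size (rem g s) = k by rewrite size_rem // ss.
have EFg : \prod_(f <- rem g s) f = F %/ g by rewrite -Eg mulKp // monic_neq0.
have [s' s'l ps'] := (Hell (F %/ g)).2 _ srem hrem EFg.
exists (g :: s'); last by apply: perm_trans ps _; rewrite perm_cons.
apply/flattenP; exists [seq g :: s | s <- ell (F %/ g)]; last by apply: map_f.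
apply: map_f; rewrite /gs mem_cat.
have [Eg1|[b Eg2]] := monic_root_factor gm g3 ga.
  have sg : size g = 2%N by rewrite Eg1 size_XsubC.
  rewrite ifT; first by rewrite Eg1 inE eqxx orbT.
  have aux (m : nat) : (m <= (2 * k).+1 -> (2 + m).-1 <= 2 * k.+1)%N by lia.
  rewrite -Eg; apply: leq_trans (size_polyMleq _ _) _; rewrite sg.
  by apply: aux; rewrite -srem; exact: size_prod_quadratics.
apply/orP; left; apply/mapP; exists b; last exact: Eg2.
rewrite -root_prod_XsubC.
have : ('X - a%:P) * (('X - b%:P) * \prod_(f <- rem g s) f)
     = ('X - a%:P) * \prod_(z <- r) ('X - z%:P).
  by rewrite mulrA -Eg2 Eg EF big_cons.
by move=> /(mulfI (negbT (polyXsubC_eq0 a))) <-; rewrite rootM root_XsubC eqxx.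
Qed.
End QuadraticFactorizations.

(** * Normal form of an irreducible ternary quadratic form *)

Lemma sum3 (A : nmodType) (F : 'I_3 -> A) : \sum_i F i = F 0 + F 1 + F 2.
Proof.
rewrite !big_ord_recl big_ord0 addr0 addrA.
by congr (_ + _ + _); congr F; apply: val_inj.
Qed.

Section QuadraticForms.
Variable C : numClosedFieldType.

Lemma linear_form_coords (L : V C 1) :
  exists a : 'cV[C]_3, val L = \sum_i a i 0 *: 'X_i.
Proof.
exists (\col_i (val L)@_U_(i)); apply/mpolyP => m.
rewrite raddf_sum /=; under eq_bigr do rewrite mxE mcoeffZ mcoeffX.
have [/eqP m1|m1] := boolP (mdeg m == 1%N); last first.
  rewrite (dhomog_nemf_coeff (dhomog_is_dhomog L) m1) big1 // => i _.
  have [E|_] := eqVneq U_(i)%MM m; last by rewrite mulr0.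
  by rewrite -E mdeg1 in m1.
have /mdeg1P[i /eqP ->] : mdeg m == 1%N by apply/eqP.
rewrite (bigD1 i) //= eqxx mulr1 big1 ?addr0 // => j ji.
rewrite (_ : (U_(j) == U_(i))%MM = false) ?mulr0 //.
by apply: contraNF ji => /eqP/mnmP/(_ j); rewrite !mnm1E eqxx; case: eqVneq.
Qed.

Lemma quadratic_form_coords (Q : V C 2) :
  exists A : 'M[C]_3, val Q = \sum_i \sum_j A i j *: ('X_i * 'X_j).
Proof.
rewrite [val Q]mpolyE; have /dhomogP := dhomog_is_dhomog Q.
move: (msupp _) => s hs.
elim: s hs => [_|m s IH hs].
  exists 0; rewrite big_nil big1 // => i _; rewrite big1 // => j _.
  by rewrite mxE scale0r.
have [A EA] := IH (fun m' h => hs m' (@mem_behead _ (m :: s) m' h)).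
have m2 : mdeg m == 2%N by apply/eqP; exact: hs (mem_head _ _).
have /existsP[i mi] : [exists i, (0 < m i)%N].
  apply: contraT; rewrite negb_exists => /forallP h; move: m2.
  by rewrite mdegE big1 // => i _; have := h i; case: (m i).
have Em : m = (U_(i) + (m - U_(i)))%MM by rewrite addmC submK // lep1mP -lt0n.
have /mdeg1P[j /eqP Ej] : mdeg (m - U_(i))%MM == 1%N.
  by move: m2; rewrite {1}Em mdegD mdeg1.
exists (A + (val Q)@_m *: delta_mx i j); rewrite big_cons EA.
under [RHS]eq_bigr do under eq_bigr do rewrite !mxE scalerDl.
under [RHS]eq_bigr do rewrite big_split.
rewrite big_split /= addrC; congr (_ + _).
rewrite (bigD1 i) //= [X in _ + X]big1 ?addr0; last first.
  by move=> i' /negbTE n; rewrite big1 // => j' _; rewrite n mulr0 scale0r.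
rewrite (bigD1 j) //= big1 ?addr0; last first.
  by move=> j' /negbTE n; rewrite n andbF mulr0 scale0r.
by rewrite !eqxx mulr1 Em -Ej mpolyXD.
Qed.

Lemma binary_quadratic_splits (a b c : C) : exists p r s t : C,
  forall x y, a * x ^+ 2 + b * (x * y) + c * y ^+ 2
    = (p * x + r * y) * (s * x + t * y).
Proof.
have [->|an0] := eqVneq a 0.
  by exists 0, 1, b, c => x y; ring.
pose d := sqrtC (b ^+ 2 - 4 * a * c).
have Ed : d ^+ 2 = b ^+ 2 - 4 * a * c by rewrite sqrtCK.
exists a, ((b - d) / 2), 1, ((b + d) / (2 * a)) => x y.
have -> : c = (b ^+ 2 - d ^+ 2) / (4 * a) by rewrite Ed; field.
by field.
Qed.

Variable A : 'M[C]_3.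
Implicit Types u v w : 'rV[C]_3.

(* [q] is the quadratic form with coefficient matrix [A], and [B] its polar form. *)
Let bil u v : C := (u *m A *m v^T) 0 0.
Let q u := bil u u.
Let B u v := bil u v + bil v u.

Let bilDl u v w : bil (u + v) w = bil u w + bil v w.
Proof. by rewrite /bil !mulmxDl mxE. Qed.
Let bilDr u v w : bil w (u + v) = bil w u + bil w v.
Proof. by rewrite /bil linearD mulmxDr mxE. Qed.
Let bilZl x u v : bil (x *: u) v = x * bil u v.
Proof. by rewrite /bil -!scalemxAl mxE. Qed.
Let bilZr x u v : bil u (x *: v) = x * bil u v.
Proof. by rewrite /bil linearZ -scalemxAr mxE. Qed.
Let bilE := (bilDl, bilDr, bilZl, bilZr).

Let q3 x y z u v w : q (x *: u + y *: v + z *: w) =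
  x ^+ 2 * q u + y ^+ 2 * q v + z ^+ 2 * q w
  + x * y * B u v + x * z * B u w + y * z * B v w.
Proof. by rewrite /q /B !bilE; ring. Qed.

Variable Q : V C 2.
Hypothesis QE : val Q = \sum_i \sum_j A i j *: ('X_i * 'X_j).
Hypothesis Q_irr : irreducible_elt (val Q).

Let QeE u : (val Q).@[fun i => u 0 i] = q u.
Proof.
rewrite QE raddf_sum /q /bil mxE /=.
under eq_bigr do rewrite raddf_sum /=.
rewrite exchange_big; apply: eq_bigr => j _.
rewrite [in RHS]mxE [in RHS]mxE mulr_suml; apply: eq_bigr => i _.
by rewrite /= mevalZ mevalM !mevalXU; ring.
Qed.

(* If the values of [Q] are products of values of two linear forms, then [Q] is
   the product of these forms: the values of a quadratic form determine its
   symmetrized coefficients. *)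
Let not_product (l m : 'cV[C]_3) :
  ~ (forall u, q u = (u *m l) 0 0 * (u *m m) 0 0).
Proof.
move=> h; pose Lin (l : 'cV[C]_3) : {mpoly C[3]} := \sum_i l i 0 *: 'X_i.
pose A' := A - l *m m^T.
have AA i j : A' i j + A' j i = 0.
  pose e i : 'rV[C]_3 := delta_mx 0 i.
  have b i' j' : bil (e i') (e j') = A i' j'.
    by rewrite /bil /e -rowE trmx_delta -colE !mxE.
  have li i' (k : 'cV[C]_3) : (e i' *m k) 0 0 = k i' 0 by rewrite -rowE mxE.
  have := h (e i + e j); have := h (e i); have := h (e j).
  rewrite /q !bilE !b !mulmxDl ![(_ + _ : 'M_1) _ _]mxE !li !mxE !big_ord1 !mxE.
  move=> h1 h2 h3; have -> : ord0 = 0 :> 'I_1 by exact: val_inj.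
  transitivity (A i i + A i j + (A j i + A j j) - A i i - A j j
                - l i 0 * m j 0 - l j 0 * m i 0); first by ring.
  by rewrite h3 h1 h2; ring.
have E : val Q = Lin l * Lin m.
  apply/eqP; rewrite -subr_eq0; apply/eqP.
  have -> : val Q - Lin l * Lin m = \sum_i \sum_j A' i j *: ('X_i * 'X_j).
    rewrite QE /Lin mulr_suml -sumrB; apply: eq_bigr => i _.
    rewrite mulr_sumr -sumrB; apply: eq_bigr => j _.
    by rewrite !mxE big_ord1 !mxE -scalerAl -scalerAr scalerA -scalerBl.
  set S := \sum_i _; have : S + S = 0.
    rewrite {2}/S exchange_big -big_split big1 // => i _.
    rewrite -big_split big1 // => j _ /=.
    by rewrite ['X_j * _]mulrC -scalerDl AA scale0r.
  by rewrite -mulr2n -scaler_nat => /eqP; rewrite scaler_eq0 pnatr_eq0 => /eqP.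
have nu k : Lin k \isn't a GRing.unit.
  apply/negP => /mulrV /(congr1 (meval (fun=> 0))).
  rewrite mevalM meval1 raddf_sum big1 ?mul0r => [/eqP|i _ /=].
    by rewrite eq_sym oner_eq0.
  by rewrite mevalZ mevalXU mulr0.
by have [_ _ /(_ _ _ E)[]] := Q_irr; exact/negP/nu.
Qed.

Let not_product_basis M (p s : 'cV[C]_3) : M \in unitmx ->
  ~ (forall u, q (u *m M) = (u *m p) 0 0 * (u *m s) 0 0).
Proof.
move=> uM h; apply: (@not_product (invmx M *m p) (invmx M *m s)) => u.
by rewrite !mulmxA -h mulmxKV.
Qed.

(** In suitable coordinates an irreducible ternary quadratic form is
    [x z - y^2]. The first basis vector [a] is isotropic. It is outside the
    radical, since otherwise the form would depend on two coordinates and split;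
    hence a second isotropic vector [b] can be chosen with polar product 1 with
    [a]. A vector [c] polar to both is anisotropic, since otherwise the form
    would be [x z]; it is scaled to take the value [-1]. *)
Lemma conic_normal_form : exists2 M : 'M[C]_3, M \in unitmx &
  forall u, (val Q).@[fun i => (u *m M) 0 i] = u 0 0 * u 0 2 - u 0 1 ^+ 2.
Proof.
have rowE3 M u : u *m M = u 0 0 *: row 0 M + u 0 1 *: row 1 M + u 0 2 *: row 2 M.
  by rewrite mulmx_sum_row sum3.
have colE3 (p : 'cV[C]_3) u :
    (u *m p) 0 0 = u 0 0 * p 0 0 + u 0 1 * p 1 0 + u 0 2 * p 2 0.
  by rewrite mxE sum3.
have Bs u v : B u v = B v u by rewrite /B addrC.
have Buu u : B u u = 2 * q u by rewrite /B /q; ring.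
have BDr u v w : B u (v + w) = B u v + B u w by rewrite /B !bilE; ring.
have BZr x u v : B u (x *: v) = x * B u v by rewrite /B !bilE; ring.
(* The line through the first two coordinate points meets the conic. *)
have [a an0 qa] : exists2 a, a != 0 & q a = 0.
  pose e i : 'rV[C]_3 := delta_mx 0 i.
  have en0 i : e i != 0.
    by apply/eqP => /matrixP /(_ 0 i); rewrite !mxE !eqxx => /eqP; rewrite oner_eq0.
  have [q1|q1] := eqVneq (q (e 1)) 0; first by exists (e 1).
  pose b := B (e 0) (e 1).
  pose d := sqrtC (b ^+ 2 - 4 * q (e 0) * q (e 1)).
  have Ed : d ^+ 2 = b ^+ 2 - 4 * q (e 0) * q (e 1) by rewrite sqrtCK.
  exists (1 *: e 0 + ((d - b) / (2 * q (e 1))) *: e 1 + 0 *: e 0).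
    apply/eqP => /matrixP /(_ 0 0); rewrite !mxE !eqxx /= => /eqP.
    by rewrite mulr0 mul0r !addr0 mulr1 oner_eq0.
  rewrite q3 -/b.
  have -> : q (e 0) = (b ^+ 2 - d ^+ 2) / (4 * q (e 1)) by rewrite Ed; field.
  by field.
have [b Bab] : exists b, B a b != 0.
  apply: contrapT => nb.
  have Ba0 v : B a v = 0.
    by apply/eqP; apply: contrapT => /negP h; apply: nb; exists v.
  (* The row space of [a] is spanned by the first row of the invertible [M]. *)
  pose M := row_ebase a.
  have [c cn0 Ea] : exists2 c, c != 0 & a = c *: row 0 M.
    have := mulmx_ebase a; rewrite [col_ebase a]mx11_scalar -mulmxA mul_scalar_mx.
    have -> : \rank a = 1%N by rewrite rank_rV an0.
    move=> Ea; exists (col_ebase a 0 0).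
      by apply: contraNneq an0 => E; rewrite -Ea E scale0r.
    rewrite -{1}Ea; congr (_ *: _); rewrite rowE; congr (_ *m _).
    by apply/matrixP => i j; rewrite (ord1 i) !mxE -val_eqE /= andbT eq_sym.
  have BM v : B (row 0 M) v = 0.
    have := Ba0 v; rewrite Bs Ea BZr Bs => /eqP.
    by rewrite mulf_eq0 (negbTE cn0) => /eqP.
  have qM : q (row 0 M) = 0.
    by have /eqP := BM (row 0 M); rewrite Buu mulf_eq0 pnatr_eq0 => /eqP.
  have [p [r [s [t hs]]]] := binary_quadratic_splits
    (q (row 1 M)) (B (row 1 M) (row 2 M)) (q (row 2 M)).
  pose k3 (x y z : C) : 'cV[C]_3 := \col_i [:: x; y; z]`_i.
  apply: (@not_product_basis M (k3 0 p r) (k3 0 s t) (row_ebase_unit a)) => u.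
  rewrite !colE3 !mxE /= rowE3 q3 qM !BM !mulr0 !add0r.
  by rewrite ![_ * p]mulrC ![_ * r]mulrC ![_ * s]mulrC ![_ * t]mulrC -hs; ring.
(* The vector [b], scaled to have polar product 1 with [a] and made isotropic by
   adding a multiple of [a]; the summand [0 *: a] only matches the shape of
   [q3]. *)
pose b1 := (B a b)^-1 *: b + (- (q b / B a b ^+ 2)) *: a + 0 *: a.
have qb1 : q b1 = 0 by rewrite q3 (Bs b a) Buu qa; field.
have Bab1 : B a b1 = 1 by rewrite !BDr !BZr Buu qa; field.
(* The two polarity conditions on [c] are two linear equations in three
   unknowns. *)
have [c cn0 [Bac Bbc]] : exists2 c, c != 0 & B a c = 0 /\ B b1 c = 0.
  pose S := A + A^T; pose N := row_mx (S *m a^T) (S *m b1^T).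
  have BS u v : B v u = (u *m (S *m v^T)) 0 0.
    rewrite /S mulmxDl mulmxDr [RHS]mxE /B addrC; congr (_ + _); rewrite /bil.
      have -> : u *m (A^T *m v^T) = (v *m A *m u^T)^T by rewrite !trmx_mul trmxK.
      by rewrite [RHS]mxE.
    by rewrite mulmxA.
  have /rowV0Pn[c cK cn0] : kermx N != 0.
    rewrite kermx_eq0 -row_leq_rank -ltnNge.
    exact: leq_ltn_trans (rank_leq_col _) _.
  exists c => //; move/sub_kermxP: cK; rewrite /N mul_mx_row -[0]row_mx0.
  by move=> /eq_row_mx[E1 E2]; rewrite !BS E1 E2 mxE.
pose mk (v0 v1 v2 : 'rV[C]_3) : 'M[C]_3 := \matrix_(i < 3) [:: v0; v1; v2]`_i.
have rmk v0 v1 v2 : [/\ row 0 (mk v0 v1 v2) = v0, row 1 (mk v0 v1 v2) = v1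
    & row 2 (mk v0 v1 v2) = v2].
  by rewrite /mk !rowK.
have qmk v u : B a v = 0 -> B b1 v = 0 ->
    q (u *m mk a v b1) = u 0 0 * u 0 2 + u 0 1 ^+ 2 * q v.
  move=> h1 h2; have [r0 r1 r2] := rmk a v b1.
  by rewrite rowE3 r0 r1 r2 q3 qa qb1 h1 (Bs v) h2 Bab1; ring.
have umk v : v != 0 -> B a v = 0 -> B b1 v = 0 -> mk a v b1 \in unitmx.
  move=> vn0 h1 h2; rewrite -row_free_unit; apply: inj_row_free => u.
  have [r0 r1 r2] := rmk a v b1; rewrite rowE3 r0 r1 r2 => E.
  have B0 w : B w 0 = 0 by rewrite -(scale0r 0) BZr mul0r.
  have u2 : u 0 2 = 0.
    by have := B0 a; rewrite -E !BDr !BZr h1 Bab1 Buu qa => <-; ring.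
  have u0 : u 0 0 = 0.
    by have := B0 b1; rewrite -E !BDr !BZr h2 (Bs b1 a) Bab1 Buu qb1 => <-; ring.
  move: E; rewrite u0 u2 !scale0r addr0 add0r => /eqP.
  rewrite scaler_eq0 (negbTE vn0) orbF => /eqP u1.
  apply/rowP => i; rewrite mxE; case: i => [[|[|[|//]]]] ?.
  - by rewrite -[RHS]u0; congr (u _ _); apply: val_inj.
  - by rewrite -[RHS]u1; congr (u _ _); apply: val_inj.
  - by rewrite -[RHS]u2; congr (u _ _); apply: val_inj.
have qc : q c != 0.
  apply/eqP => qc0.
  pose k3 (x y z : C) : 'cV[C]_3 := \col_i [:: x; y; z]`_i.
  apply: (@not_product_basis _ (k3 1 0 0) (k3 0 0 1) (umk _ cn0 Bac Bbc)) => u.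
  by rewrite !colE3 !mxE /= qmk // qc0; ring.
pose c1 := ('i / sqrtC (q c)) *: c.
have sn0 : sqrtC (q c) != 0 by rewrite sqrtC_eq0.
have h1 : B a c1 = 0 by rewrite BZr Bac mulr0.
have h2 : B b1 c1 = 0 by rewrite BZr Bbc mulr0.
exists (mk a c1 b1).
  apply: umk; rewrite // scaler_eq0 (negbTE cn0) mulf_eq0 invr_eq0.
  by rewrite (negbTE sn0) (negbTE (neq0Ci _)).
move=> u; rewrite QeE qmk //.
have -> : q c1 = -1.
  rewrite /q bilZl bilZr -/(q c) mulrA -expr2 expr_div_n sqrtCK sqrCi.
  by rewrite mulNr mul1r mulNr mulVf.
by ring.
Qed.
End QuadraticForms.

(** * Homogeneous polynomials *)

Lemma val_formB (C : fieldType) k (p q : V C k) : val (p - q) = val p - val q.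
Proof. by []. Qed.

Lemma val_formZ (C : fieldType) k c (p : V C k) : val (c *: p) = c *: val p.
Proof. by []. Qed.

Lemma meval_homog n (R : comNzRingType) k (p : {mpoly R[n]}) x v : p \is k.-homog ->
  p.@[fun i => x * v i] = x ^+ k * p.@[v].
Proof.
move=> /dhomogP hp; rewrite !mevalE mulr_sumr.
rewrite big_seq [RHS]big_seq; apply: eq_bigr => m /hp mk.
have <- : mdeg m = k by exact: mk.
rewrite mulrCA; congr (_ * _); rewrite mdegE -prodrXr -big_split.
by apply: eq_bigr => i _; rewrite exprMn.
Qed.

Lemma msize_homog n (R : nzRingType) k (p : {mpoly R[n]}) :
  p \is k.-homog -> (msize p <= k.+1)%N.
Proof.
move=> /dhomogP hp; rewrite msizeE big_seq.
by apply/bigmax_leqP_seq => m /[dup] /hp <-.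
Qed.

Lemma msize_sub_top n (R : nzRingType) d (P : {mpoly R[n]}) : (msize P <= d.+2)%N ->
  (msize (P - pihomog mdeg d.+1 P) <= d.+1)%N.
Proof.
move=> hP; rewrite {1}(pihomog_partitionE hP) big_ord_recr /= addrK.
elim/big_ind: _ => [|p p' h h'|i _]; first by rewrite msize0.
  by apply: leq_trans (msizeD_le _ _) _; rewrite geq_max h h'.
by apply: leq_trans (msize_homog (pihomogP _ _ _)) _.
Qed.

(** * Restriction of forms to a conic *)

(** [dim V(k+2) - dim V(k)] is the dimension [2 (k+2) + 1] of the space of binary
    forms of degree [2 (k+2)]. *)
Lemma conic_dimension_gap k : 'C(k.+2 + 2, k.+2) = ('C(k + 2, k) + (2 * k.+2).+1)%N.
Proof.
have e n : 'C(n + 2, n) = 'C(n + 2, 2) by rewrite -bin_sub ?leq_addr // addKn.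
by rewrite !e !addn2 !binS !bin1 !bin0; lia.
Qed.

Section PolynomialCurves.
Variable C : numClosedFieldType.
Variable g : 'I_3 -> {poly C}.

(** The polynomial [p (g 0, g 1, g 2)] in the parameter of the affine curve
    [g]. *)
Definition on_curve (p : {mpoly C[3]}) : {poly C} := mmap (@polyC C) g p.

HB.instance Definition _ := GRing.RMorphism.copy on_curve (mmap (@polyC C) g).

Lemma on_curveZ c p : on_curve (c *: p) = c *: on_curve p.
Proof. by rewrite /on_curve mmapZ mul_polyC. Qed.

Lemma on_curveX i : on_curve 'X_i = g i.
Proof. by rewrite /on_curve mmapX mmap1U. Qed.

Lemma horner_on_curve p t : (on_curve p).[t] = p.@[fun i => (g i).[t]].
Proof.
rewrite /on_curve /mmap mevalE horner_sum; apply: eq_bigr => m _.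
rewrite hornerM hornerC /mmap1 horner_prod; congr (_ * _).
by apply: eq_bigr => i _; rewrite horner_exp.
Qed.

Lemma size_on_curve k p : (forall i, (size (g i) <= 3)%N) -> p \is k.-homog ->
  (size (on_curve p) <= (2 * k).+1)%N.
Proof.
move=> g3 /dhomogP hp; rewrite /on_curve /mmap big_seq.
elim/big_ind: _ => [|a b ha hb|m mp]; first by rewrite size_poly0.
  by apply: leq_trans (size_polyD _ _) _; rewrite geq_max ha hb.
rewrite mul_polyC; apply: leq_trans (size_scale_leq _ _) _.
have <- : mdeg m = k by exact: hp.
rewrite mdegE /mmap1; elim/big_ind2: _ => [|a i b j ha hb|i _].
- by rewrite size_poly1.
- apply: leq_trans (size_polyMleq _ _) _.
  by move: (size a) (size b) ha hb => m1 m2; lia.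
- apply: leq_trans (size_poly_exp_leq _ _) _; rewrite ltnS leq_mul2r.
  by have := g3 i; case: (size _) => [|n]; lia.
Qed.

(** The linear map sending a form of degree [k] to the [2k+1] coefficients of its
    restriction to the curve; it loses nothing when the [g i] have degree at
    most 2. *)
Definition curve_row k (p : V C k) : 'rV[C]_(2 * k).+1 :=
  poly_rV (on_curve (val p)).

Lemma curve_row_linear k : linear (@curve_row k).
Proof.
move=> c p p'; apply/rowP => i.
by rewrite !mxE /= raddfD /= on_curveZ coefD coefZ.
Qed.

HB.instance Definition _ k := GRing.isLinear.Build C (V C k) 'rV[C]_(2 * k).+1 _
  (@curve_row k) (@curve_row_linear k).

End PolynomialCurves.

(* The row [u] of coordinates stands for the point [u *m M], and [Q] is in normal
   form in these coordinates. *)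
Section Conic.
Variables (C : numClosedFieldType) (Q : V C 2) (M : 'M[C]_3).
Hypothesis uM : M \in unitmx.
Hypothesis QM : forall u : 'rV[C]_3,
  (val Q).@[fun i => (u *m M) 0 i] = u 0 0 * u 0 2 - u 0 1 ^+ 2.

(** The parametrization [t |-> (1, t, t^2) M] of the projective conic [Q = 0],
    minus one point; that point corresponds to [t] infinite and is accounted for
    by the degree bounds on restrictions. *)
Definition conic_param (i : 'I_3) : {poly C} := \sum_(j < 3) M j i *: 'X^j.

Local Notation rho := (on_curve conic_param).

Lemma Q_neq0 : val Q != 0.
Proof.
apply/eqP => Q0; have := QM (\row_j (j != 1)%:R).
by rewrite Q0 meval0 !mxE /= expr0n /= mulr1 subr0 => /eqP; rewrite eq_sym oner_eq0.
Qed.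

Lemma conic_paramE t i : (conic_param i).[t] = ((\row_(j < 3) t ^+ j) *m M) 0 i.
Proof.
rewrite mxE horner_sum; apply: eq_bigr => j _.
by rewrite hornerZ hornerXn mxE mulrC.
Qed.

Lemma size_conic_param i : (size (conic_param i) <= 3)%N.
Proof.
apply: leq_trans (size_sum _ _ _) _; apply/bigmax_leqP => j _.
by apply: leq_trans (size_scale_leq _ _) _; rewrite size_polyXn.
Qed.

Lemma conic_param_on_conic : rho (val Q) = 0.
Proof.
apply: poly_eval_eq0 => t; rewrite horner_on_curve.
by rewrite (meval_eq _ (conic_paramE t)) QM !mxE /=; ring.
Qed.

Lemma rho_VQ k (p : V C k) : p \in VQ Q k -> rho (val p) = 0.
Proof.
case: k p => [|[|k]] p /=; try by rewrite memv0 => /eqP ->; rewrite raddf0.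
case/memv_imgP => h _ ->; rewrite lfunE /= rmorphM /=.
by rewrite conic_param_on_conic mul0r.
Qed.

Lemma rho_linear_form (a : 'cV[C]_3) :
  rho (\sum_i a i 0 *: 'X_i) = \sum_(j < 3) (M *m a) j 0 *: 'X^j.
Proof.
rewrite raddf_sum /=.
under eq_bigr do rewrite on_curveZ on_curveX scaler_sumr.
rewrite exchange_big; apply: eq_bigr => j _.
rewrite mxE scaler_suml; apply: eq_bigr => i _.
by rewrite scalerA mulrC.
Qed.

Lemma rho1_inj (L : V C 1) : rho (val L) = 0 -> L = 0.
Proof.
have [a Ea] := linear_form_coords L; rewrite Ea rho_linear_form => E.
have Ma : M *m a = 0.
  apply/colP => j; rewrite [RHS]mxE.
  have /(congr1 (fun p : {poly C} => p`_j)) := E.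
  rewrite coef0 coef_sum (bigD1 j) //= big1 ?addr0.
    by rewrite coefZ coefXn eqxx mulr1.
  move=> i; rewrite coefZ coefXn -val_eqE eq_sym => /negbTE ->.
  by rewrite mulr0.
apply: val_inj; rewrite Ea /= big1 // => i _.
by rewrite -(mulKmx uM a) Ma mulmx0 mxE scale0r.
Qed.

Lemma rho1_surj (f : {poly C}) : (size f <= 3)%N ->
  exists L : V C 1, rho (val L) = f.
Proof.
move=> f3; pose a := invmx M *m \col_(j < 3) f`_j.
have hL : \sum_i a i 0 *: 'X_i \is [in C[3], 1.-homog].
  by apply: rpred_sum => i _; apply: rpredZ; rewrite dhomogX; apply/eqP; exact: mdeg1.
exists (DHomog hL); rewrite /= rho_linear_form mulKVmx //.
under eq_bigr do rewrite mxE.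
rewrite -poly_def; apply/polyP => i; rewrite coef_poly.
by case: ltnP => // /(leq_trans f3) h; rewrite nth_default.
Qed.

Lemma rho_linprod k (L : 'I_k -> V C 1) :
  rho (val (linprod L)) = \prod_(l < k) rho (val (L l)).
Proof. by rewrite rmorph_prod. Qed.

Lemma rho_prod_surj k (F : {poly C}) : (size F <= (2 * k.+1).+1)%N ->
  exists L : nat -> V C 1, rho (val (linprod (fun l : 'I_k.+1 => L l))) = F.
Proof.
move=> /factor_into_quadratics[f [sf ->]].
have /choice[L hL] i := rho1_surj (sf i).
by exists L; rewrite rho_linprod; apply: eq_bigr => i _.
Qed.

(** A form that vanishes on the conic is a multiple of [Q]: restriction to the
    conic maps [V k] onto a space of dimension [2k+1], so its kernel has the same
    dimension as the subspace [VQ k] that it contains. *)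
Lemma rho_ker k (p : V C k.+1) : rho (val p) = 0 -> p \in VQ Q k.+1.
Proof.
case: k p => [|k] p hp; first by rewrite memv0 (rho1_inj hp).
pose f := linfun (@curve_row C conic_param k.+2).
have fE p' : (f p' == 0) = (rho (val p') == 0).
  rewrite lfunE /= /curve_row; apply/eqP/eqP => [h|->]; last first.
    by apply/rowP => i; rewrite !mxE coef0.
  rewrite -[LHS](@poly_rV_K _ (2 * k.+2).+1) ?h ?raddf0 //.
  exact: size_on_curve size_conic_param (dhomog_is_dhomog p').
have sub : (VQ Q k.+2 <= lker f)%VS.
  by apply/subvP => v /rho_VQ h; rewrite memv_ker fE h.
have /eqP -> : VQ Q k.+2 == lker f; last by rewrite memv_ker fE hp.
rewrite eqEdim sub /=.
have dV n : \dim (fullv : {vspace V C n}) = 'C(n + 2, n) by rewrite dimvf.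
have imf : limg f = fullv.
  apply/vspaceP => v; rewrite memvf; apply/memv_imgP.
  have [L hL] := rho_prod_surj (size_poly _ _ : (size (rVpoly v) <= (2 * k.+2).+1)%N).
  exists (linprod (fun l : 'I_k.+2 => L l)); rewrite ?memvf // lfunE /=.
  by rewrite /curve_row hL rVpolyK.
have dVQ : \dim (limg (linfun (@mulQ C Q k))) = 'C(k + 2, k).
  rewrite limg_dim_eq ?dV //; apply/eqP; rewrite capfv; apply/lker0P.
  move=> x y; rewrite !lfunE => /(congr1 val) /= /(mulfI Q_neq0).
  exact: val_inj.
have := limg_ker_dim f fullv; rewrite capfv imf dV dVQ dimvf.
by rewrite [dim _]mul1n conic_dimension_gap => /addIn ->.
Qed.

(** * Existence of multipole expansions *)

Lemma rho_nonzero_form (L : linear_form0 C) : rho (val (val L)) != 0.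
Proof. by apply: contraNneq (valP L) => /rho1_inj ->. Qed.

Lemma rho_tuple_prod k (L : mtuple C k) :
  rho (val (tuple_prod L)) = \prod_i rho (val (val (L i))).
Proof. exact: rho_linprod. Qed.

Lemma rho_tuple_prod_neq0 k (L : mtuple C k) : rho (val (tuple_prod L)) != 0.
Proof. by rewrite rho_tuple_prod; apply/prodf_neq0 => i _; exact: rho_nonzero_form. Qed.

(** On the quadric [Q = 1] a multiple of [Q] agrees with its cofactor. *)
Lemma VQ_on_quadric k (p : V C k.+1) : p \in VQ Q k.+1 ->
  exists2 h : {mpoly C[3]}, (msize h <= k.+1)%N &
    forall v, (val Q).@[v] = 1 -> (val p).@[v] = h.@[v].
Proof.
case: k p => [|k] p /=.
  by rewrite memv0 => /eqP ->; exists 0; rewrite ?msize0.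
case/memv_imgP => h _ ->; exists (val h).
  by apply: leq_trans (msize_homog (dhomog_is_dhomog h)) _.
by move=> v Qv; rewrite lfunE /= mevalM Qv mul1r.
Qed.

(** The top form of [P] has the same restriction to the conic as some product of
    linear forms, so the two differ by [Q * h]; on the quadric this difference
    equals [h], of lower degree. *)
Lemma multipole_expansion d (P : {mpoly C[3]}) : (msize P <= d.+1)%N ->
  exists (lam : C) (L : nat -> nat -> V C 1), forall v, (val Q).@[v] = 1 ->
    P.@[v] = lam + \sum_(k < d) \prod_(l < k.+1) (val (L k l)).@[v].
Proof.
elim: d P => [|d IH] P hP.
  exists (P@_0%MM), (fun _ _ => 0) => v _.
  by rewrite {1}(msize1_polyC hP) mevalC big_ord0 addr0.
pose T : V C d.+1 := DHomog (pihomogP mdeg d.+1 P).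
have [Ld hLd] := rho_prod_surj
  (size_on_curve size_conic_param (dhomog_is_dhomog T)).
have /rho_ker/VQ_on_quadric[h sh hh] :
    rho (val (T - linprod (fun l : 'I_d.+1 => Ld l))) = 0.
  by rewrite val_formB raddfB /= hLd subrr.
have sP' : (msize (P - val T + h) <= d.+1)%N.
  by apply: leq_trans (msizeD_le _ _) _; rewrite geq_max sh msize_sub_top.
have [lam [L hL]] := IH _ sP'.
exists lam, (fun k => if k == d then Ld else L k) => v Qv.
rewrite big_ord_recr /= eqxx addrA.
under eq_bigr => k _ do rewrite (ltn_eqF (ltn_ord k)).
rewrite -hL // mevalD -hh // val_formB !mevalB -rmorph_prod /=.
by ring.
Qed.

(** The class modulo [Q] is nonzero because a product of nonzero linear forms does
    not vanish on the conic. *)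
Lemma linprod_multipole k (L : 'I_k -> V C 1) : linprod L != 0 ->
  exists w : multipole C k, [/\ mprod w = linprod L,
    Phi Q w = modQ Q (linprod L) & Phi Q w != 0].
Proof.
move=> Ln0; have L0 l : L l != 0.
  apply: contraNneq Ln0 => E; apply/eqP/val_inj => /=.
  by rewrite (bigD1 l) //= E mul0r.
pose T : mtuple C k := [ffun l => exist (fun v : V C 1 => v != 0) _ (L0 l)].
have ET : mprod (\pi_(multipole C k)%qT T) = linprod L.
  rewrite mprod_pi; apply: val_inj => /=.
  by apply: eq_bigr => l _; rewrite ffunE.
exists (\pi_(multipole C k)%qT T); split; rewrite // /Phi ET //.
apply/eqP => E; have : linprod L - 0 \in VQ Q k.
  by apply/modQP; rewrite E /modQ raddf0.
rewrite subr0 -ET => /rho_VQ /eqP.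
by rewrite (negbTE (rho_tuple_prod_neq0 _)).
Qed.

(** * Counting representing sequences *)

(** If an inhomogeneous combination of forms vanishes on the quadric [Q = 1], its
    top form vanishes on the conic [Q = 0]. For fixed [t] the point
    [(1, t, t^2 + s^2) M] takes the value [s^2] at [Q], so dividing it by
    [s != 0] gives a point of the quadric; clearing the denominators and setting
    [s] to 0 leaves the top form at the point of the conic with parameter [t]. *)
Lemma top_form_vanishes d (D : forall k : 'I_d.+1, V C k.+1) (c : C) :
  (forall v, (val Q).@[v] = 1 -> c + \sum_k (val (D k)).@[v] = 0) ->
  rho (val (D ord_max)) = 0.
Proof.
move=> hD; apply: poly_eval_eq0 => t.
pose h (i : 'I_3) : {poly C} :=
  \sum_(j < 3) M j i *: ((t ^+ j)%:P + (j == 2)%:R *: 'X^2).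
have hE s i : (h i).[s] = ((\row_(j < 3) (t ^+ j + (j == 2)%:R * s ^+ 2)) *m M) 0 i.
  rewrite mxE horner_sum; apply: eq_bigr => j _.
  by rewrite !(hornerZ, hornerXn, hornerD, hornerC) mxE mulrC.
pose H := c *: 'X^(d.+1) + \sum_(k < d.+1) 'X^(d - k) * on_curve h (val (D k)).
have Hs s : s != 0 -> H.[s] = 0.
  move=> s0; pose v i := (h i).[s].
  have Qv : (val Q).@[v] = s ^+ 2.
    by rewrite (meval_eq _ (hE s)) QM !mxE /=; ring.
  have := hD (fun i => s^-1 * v i).
  rewrite (meval_homog _ _ (dhomog_is_dhomog Q)) Qv -exprMn mulVf // expr1n.
  move=> /(_ erefl) E.
  rewrite -[RHS](mulr0 (s ^+ d.+1)) -E mulrDr /H hornerD hornerZ hornerXn mulrC.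
  congr (_ + _); rewrite horner_sum mulr_sumr; apply: eq_bigr => k _.
  rewrite hornerM hornerXn horner_on_curve -/v.
  rewrite (meval_homog _ _ (dhomog_is_dhomog (D k))) mulrA; congr (_ * _).
  have Ed : (d - k + k.+1)%N = d.+1 by have := ltn_ord k; lia.
  have -> : s ^+ d.+1 = s ^+ (d - k) * s ^+ k.+1 by rewrite -exprD Ed.
  by rewrite exprVn mulfK // expf_neq0.
have H0 : H = 0.
  have /eqP : 'X * H = 0.
    apply: poly_eval_eq0 => s; rewrite hornerM hornerX.
    by have [->|/Hs ->] := eqVneq s 0; rewrite ?mul0r ?mulr0.
  by rewrite mulf_eq0 polyX_eq0 => /eqP.
have : H.[0] = 0 by rewrite H0 horner0.
rewrite /H hornerD hornerZ hornerXn expr0n mulr0 add0r.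
rewrite horner_sum big_ord_recr /= subnn mul1r big1 ?add0r => [|k _].
  rewrite !horner_on_curve => E; rewrite -[RHS]E; apply: meval_eq => i.
  rewrite conic_paramE hE; congr ((_ *m _) _ _); apply/rowP => j.
  by rewrite !mxE expr0n mulr0 addr0.
by rewrite hornerM hornerXn expr0n subn_eq0 leqNgt ltn_ord mul0r.
Qed.

(** The monic polynomial proportional to a nonzero [p]. *)
Definition monic_part (p : {poly C}) := (lead_coef p)^-1 *: p.

Lemma monic_part_prod I (r : seq I) (f : I -> {poly C}) :
  \prod_(i <- r) monic_part (f i) = monic_part (\prod_(i <- r) f i).
Proof. by rewrite /monic_part scaler_prod lead_coef_prod prodfV. Qed.

Lemma monic_part_monic p : p != 0 -> monic_part p \is monic.
Proof. by move=> p0; rewrite monicE lead_coefZ mulVf ?lead_coef_eq0. Qed.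

(** The list of the monic restrictions to the conic of the linear factors of a
    multipole, in the order of the chosen representative. *)
Definition factor_type k (w : multipole C k) : k.-tuple {poly C} :=
  [tuple monic_part (rho (val (val (repr w i)))) | i < k].

(** A linear form is determined by its restriction to the conic, so equal factor
    types up to order mean proportional factors up to order; equality of the
    products makes the proportionality constants multiply to 1. *)
Lemma factor_type_inj k (w w' : multipole C k) :
  perm_eq (factor_type w) (factor_type w') ->
  rho (val (mprod w)) = rho (val (mprod w')) -> w = w'.
Proof.
move=> /tuple_permP[s Es] E.
pose L := repr w; pose L' := repr w'.
pose lc (K : linear_form0 C) := lead_coef (rho (val (val K))).
have lcn0 K : lc K != 0 by rewrite lead_coef_eq0 rho_nonzero_form.
pose c i := lc (L i) / lc (L' (s i)).
have cn0 i : c i != 0 by rewrite mulf_neq0 ?invr_eq0.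
have EL i : val (L i) = c i *: val (L' (s i)).
  have := congr1 (fun u : seq {poly C} => nth 0 u i) Es.
  rewrite !(nth_mktuple, tnth_mktuple) => Ei.
  apply/eqP; rewrite -subr_eq0; apply/eqP/rho1_inj.
  rewrite val_formB val_formZ raddfB /= on_curveZ.
  apply/eqP; rewrite subr_eq0 /c -scalerA; apply/eqP.
  by rewrite -[_^-1 *: _]Ei scalerA divff ?scale1r // lcn0.
have c1 : \prod_i c i = 1.
  move: E; rewrite !rho_tuple_prod -/L -/L'.
  under eq_bigr do rewrite EL val_formZ on_curveZ.
  rewrite scaler_prod.
  have <- : \prod_i rho (val (val (L' i))) = \prod_i rho (val (val (L' (s i)))).
    exact: (reindex_inj (@perm_inj _ s)).
  rewrite -rho_tuple_prod => /eqP; rewrite -subr_eq0 -{2}[rho _]scale1r -scalerBl.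
  by rewrite scaler_eq0 (negbTE (rho_tuple_prod_neq0 _)) orbF subr_eq0 => /eqP.
rewrite -[w]reprK -[w']reprK; apply/esym/eqquotP/asboolP.
exists (rescale (Rescaling cn0 c1) \o permute s).
  by apply: Sigma_comp; [exact: Sigma_rescale|exact: Sigma_permute].
by apply/ffunP => i; apply: val_inj; rewrite !ffunE /= ffunE -EL.
Qed.

(** The products with a given restriction to the conic are counted by an injective
    code. For [F = 0] the only one is the zero product, since a product of
    nonzero linear forms does not vanish on the conic. *)
Lemma multipole_fiber_count k (F : {poly C}) :
  exists f : multipole_bar C k -> nat,
    (forall w, rho (val (mbarprod w)) = F -> (f w < odd_dfact k)%N) /\
    (forall w w', rho (val (mbarprod w)) = F -> rho (val (mbarprod w')) = F ->
       f w = f w' -> w = w').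
Proof.
have df0 : (0 < odd_dfact k)%N.
  by rewrite /odd_dfact big_nat prodn_cond_gt0 // => j; lia.
have [->|Fn0] := eqVneq F 0.
  have wN w : rho (val (mbarprod w)) = 0 -> w = None :> multipole_bar C k.
    by case: w => [w|] //= /eqP; rewrite (negbTE (rho_tuple_prod_neq0 _)).
  exists (fun=> 0%N); split=> // w w' /wN -> /wN -> //.
have [l [sl hl]] := count_quadratic_factorizations k (monic_part F).
pose f (w : multipole_bar C k) :=
  if w is Some w then find (perm_eq (factor_type w)) l else 0%N.
have hasl (w : multipole C k) :
    rho (val (mprod w)) = F -> has (perm_eq (factor_type w)) l.
  move=> Ew; have [||| s' s'l ps] := hl (factor_type w).
  - exact: size_tuple.
  - apply/allP => p /tnthP[i ->].
    rewrite tnth_mktuple monic_part_monic ?rho_nonzero_form //=.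
    apply: leq_trans (size_scale_leq _ _) _.
    exact: size_on_curve size_conic_param (dhomog_is_dhomog _).
  - by rewrite big_tuple; under eq_bigr do rewrite tnth_mktuple;
      rewrite monic_part_prod -rho_tuple_prod Ew.
  - by apply/hasP; exists s'.
have S0 : rho (val (mbarprod (None : multipole_bar C k))) <> F.
  by move=> E; rewrite -E raddf0 eqxx in Fn0.
exists f; split=> [[w|] // Ew|[w|] [w'|] // Ew Ew' Ef].
  by apply: leq_trans sl; rewrite -has_find; exact: hasl.
congr Some; apply: factor_type_inj; last by rewrite [LHS]Ew [RHS]Ew'.
have h := nth_find [::] (hasl _ Ew); have h' := nth_find [::] (hasl _ Ew').
rewrite /= in Ef; rewrite Ef in h.
by apply: perm_trans h _; rewrite perm_sym.
Qed.

(** The sequence of multipoles [w] represents the function [p] on the quadric. An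
    arbitrary function is allowed, so that the products can be subtracted one
    after the other without keeping track of degrees. *)
Definition represents d (p : ('I_3 -> C) -> C)
    (w : forall k : 'I_d, multipole_bar C k.+1) :=
  exists lam : C, forall v, (val Q).@[v] = 1 ->
    p v = lam + \sum_(k < d) (val (mbarprod (w k))).@[v].

(** The sequence [w] without its multipole of highest degree. *)
Definition lower d (w : forall k : 'I_d.+1, multipole_bar C k.+1) (k : 'I_d) :
  multipole_bar C k.+1 := w (widen_ord (leqnSn d) k).

Lemma lower_inj d (w w' : forall k : 'I_d.+1, multipole_bar C k.+1) :
  w ord_max = w' ord_max -> lower w = lower w' -> w = w'.
Proof.
move=> Em El; apply: functional_extensionality_dep => k.
have [kd|kd] := ltnP k d.
  have -> : k = widen_ord (leqnSn d) (Ordinal kd) by exact: val_inj.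
  exact: (congr1 (fun u : forall j : 'I_d, multipole_bar C j.+1 =>
                    u (Ordinal kd)) El).
suff -> : k = ord_max by [].
by apply: val_inj; apply/eqP; rewrite eqn_leq kd -ltnS ltn_ord.
Qed.

(** By [top_form_vanishes] all representing sequences have the same restriction of
    the top product to the conic, hence at most [(2d+1)!!] top multipoles when
    the top degree is [d+1]; for each of them the remaining multipoles represent
    the difference. The injective code is the mixed-radix combination of the two
    codes. *)
Lemma representing_count d (p : ('I_3 -> C) -> C) :
  exists f : (forall k : 'I_d, multipole_bar C k.+1) -> nat,
    (forall w, represents p w -> (f w < \prod_(1 <= k < d.+1) odd_dfact k)%N) /\
    (forall w w', represents p w -> represents p w' -> f w = f w' -> w = w').
Proof.
elim: d p => [|d IH] p.
  exists (fun=> 0%N); split=> [w _|w w' _ _ _]; first by rewrite big_nil.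
  by apply: functional_extensionality_dep => -[].
have [[w0 rw0]|nw] :=
  pselect (exists w : forall k : 'I_d.+1, multipole_bar C k.+1, represents p w);
  last first.
  by exists (fun=> 0%N); split=> w; [|move=> w'] => rw; case: nw; exists w.
have same_top (w : forall k : 'I_d.+1, multipole_bar C k.+1) : represents p w ->
    rho (val (mbarprod (w ord_max))) = rho (val (mbarprod (w0 ord_max))).
  move: rw0 => [lam0 h0] [lam h].
  suff : rho (val (mbarprod (w ord_max) - mbarprod (w0 ord_max) : V C d.+1)) = 0.
    by rewrite val_formB raddfB => /eqP; rewrite subr_eq0 => /eqP.
  apply: (@top_form_vanishes d (fun k => mbarprod (w k) - mbarprod (w0 k))
            (lam - lam0)).
  move=> v Qv; under eq_bigr do rewrite val_formB mevalB.
  rewrite sumrB; have := h v Qv; rewrite (h0 v Qv) => E.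
  by rewrite addrACA -opprD E subrr.
have [g [gN gI]] := multipole_fiber_count d.+1 (rho (val (mbarprod (w0 ord_max)))).
have /choice[f hf] := IH.
pose p' m v := p v - (val (mbarprod (m : multipole_bar C d.+1))).@[v].
have low (w : forall k : 'I_d.+1, multipole_bar C k.+1) :
    represents p w -> represents (p' (w ord_max)) (lower w).
  move=> [lam h]; exists lam => v Qv.
  by rewrite /p' h // big_ord_recr /= addrA addrK.
exists (fun w : forall k : 'I_d.+1, multipole_bar C k.+1 =>
  g (w ord_max) + odd_dfact d.+1 * f (p' (w ord_max)) (lower w))%N.
split=> [w rw|w w' rw rw' E].
  have h1 := gN _ (same_top _ rw); have h2 := (hf _).1 _ (low _ rw).
  rewrite big_nat_recr //= [X in (_ < X)%N]mulnC.
  apply: leq_trans (_ : odd_dfact d.+1 * (f (p' (w ord_max)) (lower w)).+1 <= _)%N.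
    by rewrite mulnS ltn_add2r.
  by rewrite leq_mul2l h2 orbT.
have h1 := gN _ (same_top _ rw); have h1' := gN _ (same_top _ rw').
have df0 : (0 < odd_dfact d.+1)%N by apply: leq_ltn_trans h1.
have Eg : g (w ord_max) = g (w' ord_max).
  have := congr1 (modn^~ (odd_dfact d.+1)) E.
  rewrite /= ![(g _ + _)%N]addnC ![(odd_dfact _ * _)%N]mulnC !modnMDl.
  by rewrite !modn_small.
have Em := gI _ _ (same_top _ rw) (same_top _ rw') Eg.
apply: lower_inj => //; apply: ((hf (p' (w ord_max))).2 _ _ (low _ rw)).
  by rewrite Em; exact: low.
move: E; rewrite Em => /addnI /eqP; rewrite eqn_pmul2l // => /eqP; exact.
Qed.

End Conic.

(** * Multipole representations on the quadric *)

Local Open Scope classical_set_scope.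
Local Open Scope card_scope.

Lemma card_le_code T (A : set T) n (f : T -> nat) :
  (forall x, A x -> (f x < n)%N) ->
  (forall x y, A x -> A y -> f x = f y -> x = y) -> A #<= `I_n.
Proof.
move=> fn fI.
rewrite -(card_le_eql (@inj_card_eq _ _ A f _)); last first.
  by move=> x y; rewrite !inE; exact: fI.
by apply: subset_card_le => _ [x Ax <-]; exact: fn.
Qed.

Theorem theorem11 (R : realType) (Q : V R[i] 2) (P : {mpoly R[i][3]}) (d : nat)
    (Q_irr : irreducible_elt (Q : {mpoly R[i][3]})) (P_deg : mpoly_deg P = d) :
  (exists (lam : R[i]) (L : forall k : 'I_d, 'I_k.+1 -> V R[i] 1),
     (forall v : 'I_3 -> R[i], Q.@[v] = 1 ->
        P.@[v] = lam + \sum_(k < d) \prod_(l < k.+1) (L k l).@[v]) /\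
     (forall k : 'I_d, linprod (L k) != 0 ->
        exists w : multipole R[i] k.+1,
          [/\ mprod w = linprod (L k),
              Phi Q w = modQ Q (linprod (L k)) & Phi Q w != 0]))
  /\
  (finite_set (representing Q P d) /\
   representing Q P d #<= `I_(\prod_(1 <= k < d.+1) odd_dfact k)).
Proof.
have [A QA] := quadratic_form_coords Q.
have [M uM QM] := conic_normal_form QA Q_irr.
split.
  have sP : (msize P <= d.+1)%N by rewrite -P_deg /mpoly_deg leqSpred.
  have [lam [L hL]] := multipole_expansion uM QM sP.
  exists lam, (fun k l => L k l); split=> [|k]; first exact: hL.
  exact: (linprod_multipole uM QM).
have [f [fN fI]] := representing_count uM QM d (fun v => P.@[v]).
have le : representing Q P d #<= `I_(\prod_(1 <= k < d.+1) odd_dfact k).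
  exact: (card_le_code (f := f)).
by split=> //; apply/finite_set_leP; exists (\prod_(1 <= k < d.+1) odd_dfact k)%N.
Qed.
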